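(* Let $R$ be an integral domain with $\operatorname{char} R\neq 2$, let $\mathcal{A}$ be a central real hyperplane arrangement, and let $y\in\mathrm{gHeav}(\mathcal{A})$. Then there exist an integer $s\ge 0$ and an odd number $2s+1$ of hyperplanes $H_1,\dots,H_{2s+1}\in\mathcal{A}$ such that $X=\bigcap_{i=1}^{2s+1}H_i$ has codimension $2$ and $y=\mathrm{Alt}^+(H_1,\dots,H_{2s+1})$ or $y=\mathrm{Alt}^-(H_1,\dots,H_{2s+1})$.
   Context: $\mathcal{A}$ is a finite set of distinct linear hyperplanes in $\mathbb{R}^\ell$, $H_i=\alpha_i^{-1}(0)$; chambers $\mathrm{ch}(\mathcal{A})$ are connected components of the complement of $\bigcup_{H\in\mathcal{A}}H$. $\mathrm{VG}(\mathcal{A})_R$ is the $R$-algebra of all functions $\mathrm{ch}(\mathcal{A})\to R$ (pointwise operations). The Heaviside function $x_i^+$ is the indicator of chambers on which $\alpha_i>0$. $\mathrm{Fil}^1\mathrm{VG}(\mathcal{A})_R$ is the $R$-span of $1,x_1^+,\dots,x_n^+$. $\mathrm{gHeav}(\mathcal{A})$ is the set of idempotents ($y^2=y$) of $\mathrm{VG}(\mathcal{A})_R$ lying in $\mathrm{Fil}^1\mathrm{VG}(\mathcal{A})_R$, other than $0$ and $1$. For hyperplanes $H_1,\dots,H_{2s+1}\in\mathcal{A}$ whose intersection $X$ has codimension $2$, the complement of $H_1\cup\dots\cup H_{2s+1}$ consists of $4s+2$ open cones $K_1,\dots,K_{4s+2}$ around $X$, numbered in cyclic order (consecutive cones sharing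 a wall); every chamber of $\mathcal{A}$ lies in exactly one $K_j$. $\mathrm{Alt}^+(H_1,\dots,H_{2s+1})$ is the function on $\mathrm{ch}(\mathcal{A})$ that equals $1$ on chambers contained in $K_j$ with $j$ odd and $0$ on chambers contained in $K_j$ with $j$ even, and $\mathrm{Alt}^-=1-\mathrm{Alt}^+$ (so these are the two functions taking values $0,1$ alternately around $X$; for $s=0$ they are the two Heaviside functions of $H_1$).
   Formalization: The requirement that X has codimension 2 is imposed only for s > 0; for s = 0, X is the single hyperplane H_1 (codimension 1) and y is one of its two Heaviside functions, since the literal claim fails for y = x_1^+. *)

(* Defs.v *)
From mathcomp Require Import all_boot all_order all_algebra.
From mathcomp Require Import all_classical all_reals all_analysis.

Set Implicit Arguments.
Unset Strict Implicit.
Unset Printing Implicit Defensive.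

Import Order.TTheory GRing.Theory Num.Theory.
Import numFieldNormedType.Exports.

Local Open Scope classical_set_scope.
Local Open Scope ring_scope.

(* A finite set of distinct linear hyperplanes of K^l (K the field of real
   numbers), together with chosen defining forms. *)
Record arrangement (K : realType) (l : nat) := Arrangement {
  nbhyp : nat;
  form : 'I_nbhyp -> 'Hom('rV[K]_l, K^o);
  form_neq0 : forall i, form i != 0;
  form_ker_inj : injective (fun i => lker (form i))
}.

Section Chambers.
Variables (K : realType) (l : nat) (A : arrangement K l).

Definition hyperplane (i : 'I_(nbhyp A)) : {vspace 'rV[K]_l} :=
  lker (form i).

Definition codim (X : {vspace 'rV[K]_l}) : nat :=
  (\dim {: 'rV[K]_l} - \dim X)%N.

(* Sets B of indices stand for subarrangements of A. *)
Definition complement (B : {set 'I_(nbhyp A)}) : set 'rV[K]_l :=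
  [set x | forall i, i \in B -> x \notin hyperplane i].

Definition chambers_of (B : {set 'I_(nbhyp A)}) : set (set 'rV[K]_l) :=
  [set connected_component (complement B) x | x in complement B].

Definition ch : set (set 'rV[K]_l) := chambers_of [set: 'I_(nbhyp A)]%SET.

(* Two distinct chambers share a wall when their closures have in common a
   nonempty relatively open subset of one of the hyperplanes; merely having a
   bounding hyperplane in common is not enough, as opposite cones around X do. *)
Definition share_wall (B : {set 'I_(nbhyp A)}) (C D : set 'rV[K]_l) : Prop :=
  exists i (x : 'rV[K]_l), [/\ i \in B, x \in hyperplane i &
    \forall z \near x, z \in hyperplane i -> closure C z /\ closure D z].

(* The ordinal j carries the cone numbered j + 1. *)
Definition cyclic_numbering (B : {set 'I_(nbhyp A)}) (m : nat)
    (cone : 'I_m -> set 'rV[K]_l) : Prop :=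
  set_bij [set: 'I_m] (chambers_of B) cone /\
  forall j, share_wall B (cone j) (cone (ordS j)).

End Chambers.

Section VarchenkoGelfand.
Variables (K : realType) (l : nat) (A : arrangement K l) (R : idomainType).

(* R^o is R as a module over itself: the function space then carries the
   pointwise ring and R-module structures. *)
Definition VG : Type := ch A -> R^o.

Definition heaviside (i : 'I_(nbhyp A)) : VG :=
  \1_[set C : ch A | forall x, set_val C x -> 0 < (form i x : K)].

Definition Fil1 : set VG :=
  [set y | exists (c : R) (a : 'I_(nbhyp A) -> R),
     y = c *: (1 : VG) + \sum_i a i *: heaviside i].

Definition gHeav : set VG :=
  [set y | [/\ Fil1 y, y ^+ 2 = y, y <> 0 & y <> 1]].

(* Odd-numbered cones are those at even ordinals. *)
Definition Alt_plus (m : nat) (cone : 'I_m -> set 'rV[K]_l) : VG :=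
  \1_[set C : ch A | exists2 j : 'I_m, ~~ odd j & set_val C `<=` cone j].

Definition Alt_minus (m : nat) (cone : 'I_m -> set 'rV[K]_l) : VG :=
  1 - Alt_plus cone.

End VarchenkoGelfand.

Arguments Alt_plus {K l} A R {m} cone.
Arguments Alt_minus {K l} A R {m} cone.

(* Main.v *)
Require Import Defs.
From HB Require Import structures.
From mathcomp Require Import all_boot all_order all_algebra.
From mathcomp Require Import all_classical all_reals all_analysis.
From mathcomp Require Import ring lra zify.

(** Write [y = c + sum_i a_i x_i^+] and let [B] be the set of [i] with [a_i <> 0].
    As [R] is a domain, [y] only takes the values 0 and 1, and crossing a wall of
    [B] at a generic point exchanges them, so that [a_i = 1] or [a_i = -1].
    Normalize the forms of [B] by their value at a generic vector [v], changing
    the sign of [a_i] when the form is negative at [v]. The forms of [B] become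
    points of an affine space, coloured by the sign of [a_i]. If two points of the
    same colour had no third point strictly between them, one could cross their
    hyperplanes one after the other near a generic point of their intersection,
    and [y] would move twice in the same direction; so there is such a point. In
    a non-collinear triple of minimal spread two points have the same colour, and
    the point between them yields a smaller triple: hence all points are
    collinear, i.e. [B] has rank at most 2. The chambers of [B] are then the
    sectors of a pencil of lines and [y] alternates on them; comparing opposite
    sectors shows that [#|B|] is odd, since 2 is nonzero in [R]. *)

Set Implicit Arguments.
Unset Strict Implicit.
Unset Printing Implicit Defensive.

Import Order.TTheory GRing.Theory Num.Theory.
Import numFieldNormedType.Exports.
(* Another constant [form] from MathComp shadows the one of [Defs]. *)
Import Defs.

Local Open Scope classical_set_scope.
Local Open Scope ring_scope.

(** * Signs and generic points for finite families of linear forms *)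

Section SameSign.
Variable K : realFieldType.
Implicit Types s t : K.

Lemma same_sign s t : 0 < s * t -> (0 < s) = (0 < t).
Proof.
by move=> st; apply/idP/idP => [s0|t0]; move: st;
  rewrite ?(pmulr_rgt0 _ s0) ?(pmulr_lgt0 _ t0).
Qed.

Lemma same_sign_neq0 s t : 0 < s * t -> t != 0.
Proof. by apply: contraTneq => ->; rewrite mulr0 ltxx. Qed.
End SameSign.

Section GenericPoints.
Variables (K : realFieldType) (V : lmodType K).
Implicit Types (u w x : V) (f g h : {scalar V}).

Lemma perturb_same_sign (I : finType) (f : I -> {scalar V}) u w :
  exists2 e, 0 < e &
    forall i, f i u != 0 -> 0 < f i u * f i (u + e *: w).
Proof.
pose r i := `|f i w / f i u|.
have r0 i : 0 <= r i by exact: normr_ge0.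
have S0 : 0 < 1 + \sum_i r i by rewrite ltr_pwDl // sumr_ge0.
(* This step times any [f i w / f i u] has absolute value below 1. A form with [f i u = 0] adds 0 to
   the sum, as division by 0 gives 0. *)
exists (1 + \sum_i r i)^-1; first by rewrite invr_gt0.
move=> i fu; rewrite linearD linearZ /=.
have lt1 : `|(1 + \sum_i r i)^-1 * (f i w / f i u)| < 1.
  rewrite normrM gtr0_norm ?invr_gt0 // -/(r i) mulrC ltr_pdivrMr // mul1r.
  by rewrite (bigD1 i) //= addrCA ltrDl ltr_pwDl // sumr_ge0.
set e := _^-1 in lt1 *; set a := f i u in fu lt1 *; set d := f i w in lt1 *.
have -> : a * (a + e * d) = a ^+ 2 * (1 + e * (d / a)) by field.
rewrite mulr_gt0 ?exprn_even_gt0 //=.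
by move: lt1; rewrite ltr_norml => /andP[? _]; lra.
Qed.

(** A finite union of proper subspaces does not fill the subspace [U]: the forms are treated one at
    a time, each by a short move inside [U] that keeps the earlier values nonzero. *)
Lemma generic_point (I : finType) (f : I -> {scalar V}) (U : V -> Prop) :
    U 0 -> (forall a x y, U x -> U y -> U (x + a *: y)) ->
  exists2 p, U p & forall i w, U w -> f i w != 0 -> f i p != 0.
Proof.
move=> U0 Ulin.
suff [p pU Hp] : exists2 p, U p &
    forall i w, i \in enum I -> U w -> f i w != 0 -> f i p != 0.
  by exists p => // i w; apply: Hp; rewrite mem_enum.
elim: (enum I) => [|i s [p pU Hp]]; first by exists 0.
have [q [qU qi Hq]] : exists q, [/\ U q, forall w, U w -> f i w != 0 -> f i q != 0
    & forall j, f j p != 0 -> f j q != 0].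
  have [fp|fp] := eqVneq (f i p) 0; last by exists p.
  have [[w wU fw]|no_w] := pselect (exists2 w, U w & f i w != 0); last first.
    by exists p; split=> // w wU fw; case: no_w; exists w.
  have [e e0 He] := perturb_same_sign f p w.
  exists (p + e *: w); split; first exact: Ulin.
    by move=> *; rewrite linearD linearZ /= fp add0r mulf_neq0 // gt_eqF.
  by move=> j /He/same_sign_neq0.
exists q => // j w; rewrite inE => /orP[/eqP->|js wU fw]; first exact: qi.
exact/Hq/(Hp j w).
Qed.

Lemma dual_pair f g v : f v = 1 -> g v = 1 -> (exists x, f x != g x) ->
  exists u w, [/\ f u = 1, g u = 0, f w = 0, g w = 1 & u + w = v].
Proof.
move=> fv gv [q fq]; have dq : f q - g q != 0 by rewrite subr_eq0.
(* [q - g q *: v] lies in the kernel of [g], and [f] takes the nonzero value [f q - g q] there. *)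
pose u := (f q - g q)^-1 *: (q - g q *: v).
have fu : f u = 1 by rewrite linearZ linearB linearZ /= fv mulr1 mulVf.
have gu : g u = 0 by rewrite linearZ linearB linearZ /= gv mulr1 subrr mulr0.
exists u, (v - u); split; rewrite ?linearB /= ?fv ?gv ?fu ?gu ?subrr ?subr0 //.
by rewrite addrC subrK.
Qed.

Lemma scalar_combination f g h u w :
    f u = 1 -> g u = 0 -> f w = 0 -> g w = 1 ->
    (forall x, f x = 0 -> g x = 0 -> h x = 0) ->
  forall x, h x = h u * f x + h w * g x.
Proof.
move=> fu gu fw gw ker x.
have /eqP : h (x - (f x *: u + g x *: w)) = 0.
  by apply: ker; rewrite linearB linearD !linearZ /= ?fu ?gu ?fw ?gw; ring.
rewrite linearB linearD !linearZ /= subr_eq0 => /eqP->.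
by congr (_ + _); rewrite mulrC.
Qed.
End GenericPoints.

(** * Collinearity of the forms of a two-valued step function *)

Section TwoValued.
Variables (K : realFieldType) (V : lmodType K) (R : idomainType) (I : finType).
Variables (g : I -> {scalar V}) (v : V) (c : R) (b : I -> R).
Hypotheses (two_neq0 : (2 : R) != 0) (gv : forall i, g i v = 1).
Hypotheses (g_inj : forall i j, i != j -> exists x, g i x != g j x).
Hypothesis b_neq0 : forall i, b i != 0.

(** A combination of Heaviside functions evaluated at a vector. A point on a hyperplane counts as
    lying on its negative side. *)
Definition step_sum (x : V) : R := c + \sum_(i | 0 < g i x) b i.

Hypothesis two_valued :
  forall x, (forall i, g i x != 0) -> step_sum x = 0 \/ step_sum x = 1.

Lemma eq_step_sum x y : (forall i, (0 < g i x) = (0 < g i y)) ->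
  step_sum x = step_sum y.
Proof. by move=> E; rewrite /step_sum; congr (_ + _); apply: eq_bigl. Qed.

Lemma step_sum_add i x y : g i x <= 0 -> 0 < g i y ->
    (forall k, k != i -> (0 < g k x) = (0 < g k y)) ->
  step_sum y = step_sum x + b i.
Proof.
move=> xi yi E; rewrite /step_sum (bigD1 i yi) /= -addrA [b i + _]addrC.
congr (_ + (_ + _)); apply: eq_bigl => k; have [->|ki] := eqVneq k i.
  by rewrite (le_gtF xi) andbF.
by rewrite andbT E.
Qed.

(** Every form is 1 at [v], so short moves along [- v] and [v] leave the hyperplane on its two
    sides. *)
Lemma cross_hyperplane x i : g i x = 0 -> (forall k, k != i -> g k x != 0) ->
  exists x0 x1, [/\ forall k, g k x0 != 0, forall k, g k x1 != 0,
   forall k, k != i -> (0 < g k x) = (0 < g k x0) /\ (0 < g k x) = (0 < g k x1)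
   & g i x0 < 0 /\ 0 < g i x1].
Proof.
move=> gx0 gx.
have [e0 e0_gt0 E0] := perturb_same_sign g x (- v).
have [e1 e1_gt0 E1] := perturb_same_sign g x v.
have g0 : g i (x + e0 *: - v) = - e0.
  by rewrite linearD linearZ linearN /= gx0 gv add0r mulrN1.
have g1 : g i (x + e1 *: v) = e1.
  by rewrite linearD linearZ /= gx0 gv add0r mulr1.
exists (x + e0 *: - v), (x + e1 *: v); split.
- move=> k; have [->|/gx/E0/same_sign_neq0//] := eqVneq k i.
  by rewrite g0 oppr_eq0 gt_eqF.
- by move=> k; have [->|/gx/E1/same_sign_neq0//] := eqVneq k i; rewrite g1 gt_eqF.
- by move=> k /gx gk; split; apply: same_sign; [exact: E0|exact: E1].
- by rewrite g0 g1 oppr_lt0.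
Qed.

(** The sum at [x] is the value just below the hyperplane and grows by [b i] just above it; both
    values are 0 or 1, and [b i] is nonzero. *)
Lemma cross_values x i : g i x = 0 -> (forall k, k != i -> g k x != 0) ->
  (step_sum x = 0 /\ b i = 1) \/ (step_sum x = 1 /\ b i = -1).
Proof.
move=> gx0 /(cross_hyperplane gx0)[x0 [x1 [/two_valued F0 /two_valued F1 E [lt0 gt0]]]].
have e0 : step_sum x = step_sum x0.
  apply: eq_step_sum => k; have [->|/E[]//] := eqVneq k i.
  by rewrite gx0 ltxx ltNge ltW.
have e1 : step_sum x1 = step_sum x + b i.
  apply: step_sum_add => //; first by rewrite gx0.
  by move=> k /E[].
move: F0 F1; rewrite -e0 e1 => -[]-> []; rewrite ?add0r => bi.
- by have := b_neq0 i; rewrite bi eqxx.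
- by left.
- by right; split=> //; apply/eqP; rewrite -addr_eq0 addrC bi.
- have := b_neq0 i; have -> : b i = 0 by apply: (addrI 1); rewrite addr0.
  by rewrite eqxx.
Qed.

(* Near a generic point of the intersection of the two hyperplanes, crossing
   them one after the other with nothing in between would change the value
   twice in the same direction. *)
Lemma same_step_between i j : i != j -> b i = b j ->
  exists k l, [/\ 0 < l, l < 1 & forall x, g k x = l * g i x + (1 - l) * g j x].
Proof.
move=> ij bij.
have [u [w [iu ju iw jw uw]]] := dual_pair (gv i) (gv j) (g_inj ij).
have [p [pi pj] Hp] := @generic_point _ _ _ g (fun x => g i x = 0 /\ g j x = 0)
  (conj (linear0 _) (linear0 _)) ltac:(by move=> a x y [ix jx] [iy jy];
    rewrite !linearD !linearZ /= ix jx iy jy mulr0 addr0).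
(* A form vanishing at the generic point [p] vanishes on the whole intersection; the coefficients
   add up to 1, the value at [u + w = v]. *)
have span k : g k p = 0 -> forall x, g k x = g k u * g i x + (1 - g k u) * g j x.
  move=> kp x; have -> : 1 - g k u = g k w by rewrite -(gv k) -uw linearD addrC addKr.
  apply: (scalar_combination iu ju iw jw) => z iz jz.
  by apply/eqP; apply: contraT => kz; have := Hp k z (conj iz jz) kz; rewrite kp eqxx.
apply: contrapT => no_between.
have out k : g k p = 0 -> g k u <= 0 \/ 1 <= g k u.
  move=> kp; case: (lerP (g k u) 0) => [|l0]; first by left.
  case: (lerP 1 (g k u)) => [|l1]; first by right.
  by case: no_between; exists k, (g k u); split=> //; exact: span.
have ext k k' : k != k' -> g k p = 0 -> g k' p = 0 -> g k u != g k' u.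
  move=> /g_inj[x kx] kp k'p; apply: contraNneq kx => e.
  by rewrite (span k) // (span k') // e.
(* The path meets hyperplane [j] at [p - e u] and hyperplane [i] at [p + d w]. Any other form
   vanishing at [p] has [g k u] outside [0, 1], hence the same sign at both points. *)
have [e e0 E] := perturb_same_sign g p (- u).
have [d d0 D] := perturb_same_sign g p w.
have gE k : g k p = 0 -> g k (p + e *: - u) = - (e * g k u).
  by move=> kp; rewrite linearD linearZ linearN /= kp add0r mulrN.
have gD k : g k p = 0 -> g k (p + d *: w) = d * (1 - g k u).
  by move=> kp; rewrite linearD linearZ /= kp add0r -(gv k) -uw linearD addrC addKr.
have crossE : (step_sum (p + e *: - u) = 0 /\ b j = 1) \/
    (step_sum (p + e *: - u) = 1 /\ b j = -1).
  apply: cross_values; first by rewrite gE // ju mulr0 oppr0.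
  move=> k kj; have [kp|/E/same_sign_neq0//] := eqVneq (g k p) 0.
  by rewrite gE // oppr_eq0 mulf_neq0 ?(gt_eqF e0) ?(gt_eqF d0) // -ju ext.
have crossD : (step_sum (p + d *: w) = 0 /\ b i = 1) \/
    (step_sum (p + d *: w) = 1 /\ b i = -1).
  apply: cross_values; first by rewrite gD // iu subrr mulr0.
  move=> k ki; have [kp|/D/same_sign_neq0//] := eqVneq (g k p) 0.
  by rewrite gD // mulf_neq0 ?(gt_eqF e0) ?(gt_eqF d0) // subr_eq0 -iu eq_sym ext.
have ED : step_sum (p + d *: w) = step_sum (p + e *: - u) + b j.
  apply: step_sum_add; first by rewrite gE // ju mulr0 oppr0.
    by rewrite gD // ju subr0 mulr1.
  move=> k kj; have [kp|kp] := eqVneq (g k p) 0; last first.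
    by rewrite -(same_sign (E _ kp)) -(same_sign (D _ kp)).
  rewrite gE // gD // pmulr_rgt0 // oppr_gt0 pmulr_rlt0 // subr_gt0.
  have := ext _ _ kj kp pj; rewrite ju => ku0.
  by case: (out k kp) => ?; apply/idP/idP => ?; lra.
move: crossE crossD; rewrite ED bij => -[[-> bj]|[-> bj]]; rewrite bj ?add0r.
- case=> -[]; first by move=> /eqP; rewrite oner_eq0.
  move=> _ /eqP; rewrite -addr_eq0; exact/negP.
- case=> -[]; last by rewrite subrr => /esym/eqP; rewrite oner_eq0.
  move=> _ /esym/eqP; rewrite -addr_eq0; exact/negP.
Qed.

(** The hyperplanes being distinct, a generic point of the [i]-th lies on no other one and can be
    used for crossing it. *)
Lemma step_unit i : b i = 1 \/ b i = -1.
Proof.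
have [p pi Hp] := @generic_point _ _ _ g (fun x => g i x = 0) (linear0 _)
  ltac:(by move=> a x y /= ix iy; rewrite linearD linearZ /= ix iy mulr0 addr0).
have generic k : k != i -> g k p != 0.
  move=> ki; rewrite eq_sym in ki.
  have [u [w [_ _ iw kw _]]] := dual_pair (gv i) (gv k) (g_inj ki).
  by apply: (Hp k w); rewrite // kw oner_neq0.
by have [[_ ->]|[_ ->]] := cross_values pi generic; [left|right].
Qed.

(** Linear independence; as the forms have value 1 at [v], it means that the three points are not
    collinear. *)
Definition independent_triple (t : I * I * I) : Prop := forall x y z : K,
  (forall w, x * g t.1.1 w + y * g t.1.2 w + z * g t.2 w = 0) ->
  [/\ x = 0, y = 0 & z = 0].

(** Perimeter of the triangle projected to a line by evaluation at [p]. *)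
Definition triple_spread (p : V) (t : I * I * I) : K :=
  `|g t.1.1 p - g t.1.2 p| + `|g t.1.2 p - g t.2 p| + `|g t.2 p - g t.1.1 p|.

Lemma triple_rotate p i j k : independent_triple (i, j, k) ->
  independent_triple (j, k, i) /\ triple_spread p (j, k, i) = triple_spread p (i, j, k).
Proof.
move=> H; split; last by rewrite /triple_spread /= addrC addrA.
move=> x y z xyz; have [|-> -> ->//] := H z x y.
by move=> w; rewrite -[RHS](xyz w) /=; ring.
Qed.

(** The point between [i] and [j] replaces whichever of them is farther from [k] in the projection:
    one side gets strictly shorter and none longer. Independence survives because the replaced
    vertex has nonzero weight. *)
Lemma triple_shrink p i j k : (forall i j, i != j -> g i p != g j p) ->
    independent_triple (i, j, k) -> b i = b j ->
  exists t, independent_triple t /\ triple_spread p t < triple_spread p (i, j, k).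
Proof.
move=> gp ind bij.
have ij : i != j.
  apply/eqP => ij; have [|/eqP] := ind 1 (- 1) 0; last by rewrite oner_eq0.
  by move=> w /=; rewrite ij; ring.
have [d [l [l0 l1 dE]]] := same_step_between ij bij.
have l1' : 0 < 1 - l by rewrite subr_gt0.
have spij : 0 < `|g i p - g j p| by rewrite normr_gt0 subr_eq0 gp.
have spk : `|g d p - g k p| <= l * `|g i p - g k p| + (1 - l) * `|g j p - g k p|.
  have -> : g d p - g k p = l * (g i p - g k p) + (1 - l) * (g j p - g k p).
    by rewrite dE; ring.
  by rewrite (le_trans (ler_normD _ _)) // !normrM (gtr0_norm l0) (gtr0_norm l1').
have spj : `|g d p - g j p| = l * `|g i p - g j p|.
  by rewrite -[in RHS](gtr0_norm l0) -normrM dE; congr `|_|; ring.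
have spi : `|g i p - g d p| = (1 - l) * `|g i p - g j p|.
  by rewrite -[in RHS](gtr0_norm l1') -normrM dE; congr `|_|; ring.
rewrite /triple_spread /=.
case: (lerP `|g j p - g k p| `|g i p - g k p|) => cmp.
- exists (d, j, k); split=> /=; last first.
    rewrite (distrC (g k p) (g d p)) (distrC (g k p) (g i p)) spj.
    set a := `|_ - _| in spij *; set a' := `|_ - _| in spk *; nra.
  move=> x y z /= xyz; have [|xl yxl ->] := ind (x * l) (y + x * (1 - l)) z.
    by move=> w /=; rewrite -[RHS](xyz w) dE; ring.
  have x0 : x = 0 by apply/eqP; move/eqP: xl; rewrite mulf_eq0 (gt_eqF l0) orbF.
  by move: yxl; rewrite x0 mul0r addr0.
- exists (i, d, k); split=> /=; last first.
    rewrite (distrC (g k p) (g i p)) spi; nra.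
  move=> x y z /= xyz; have [|xl yl ->] := ind (x + y * l) (y * (1 - l)) z.
    by move=> w /=; rewrite -[RHS](xyz w) dE; ring.
  have y0 : y = 0.
    by apply/eqP; move/eqP: yl; rewrite mulf_eq0 subr_eq0 (gt_eqF l1) orbF.
  by move: xl; rewrite y0 mul0r addr0.
Qed.

Lemma no_independent_triple t : ~ independent_triple t.
Proof.
move=> ind.
have [p _ Hp] := @generic_point _ _ _ (fun ij : I * I => g ij.1 \- g ij.2)
  (fun _ => True) Logic.I (fun _ _ _ _ _ => Logic.I).
have gp i j : i != j -> g i p != g j p.
  move=> ij; have [w gw] := g_inj ij.
  by rewrite -subr_eq0; apply: (Hp (i, j) w) => //=; rewrite subr_eq0.
have [] := @arg_minP _ _ _ t (fun t => `[< independent_triple t >]) (triple_spread p).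
  exact/asboolP.
move=> [[i j] k] /asboolP ijk minijk.
have [jki jkiE] := triple_rotate p ijk.
have [kij kijE] := triple_rotate p jki.
have [t' [indt' lt_t']] : exists t',
    independent_triple t' /\ triple_spread p t' < triple_spread p (i, j, k).
  (* Pigeonhole: three coefficients, each 1 or -1. *)
  have [bij|[bjk|bki]] : b i = b j \/ b j = b k \/ b k = b i.
    by case: (step_unit i) (step_unit j) (step_unit k) => -> [] -> [] ->; auto.
  - exact: triple_shrink.
  - by rewrite -jkiE; exact: triple_shrink.
  - by rewrite -jkiE -kijE; exact: triple_shrink.
by have := minijk t'; rewrite leNgt lt_t' => /(_ (asboolT indt')).
Qed.

Lemma coplanar i j k : i != j ->
  exists l, forall x, g k x = l * g i x + (1 - l) * g j x.
Proof.
move=> ij; have [u [w [iu ju iw jw uw]]] := dual_pair (gv i) (gv j) (g_inj ij).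
exists (g k u) => x; have -> : 1 - g k u = g k w.
  by rewrite -(gv k) -uw linearD addrC addKr.
apply: (scalar_combination iu ju iw jw) => z iz jz.
(* If [g k z] were nonzero, evaluation at [z], [u] and [w] would make the triple independent. *)
apply: contrapT => kz; apply: (@no_independent_triple (i, j, k)) => a1 a2 a3 /= E.
have a30 : a3 = 0.
  have := E z; rewrite iz jz !mulr0 !add0r => /eqP.
  by rewrite mulf_eq0 => /orP[/eqP//|/eqP].
have := E u; have := E w; rewrite iu ju iw jw a30 !mul0r !mulr0 !mulr1 !addr0 add0r.
by [].
Qed.
End TwoValued.

(* With the half-planes of [m] concurrent lines of a plane suitably oriented and
   ordered, the [j]-th of the [2m] sectors lies in the [k]-th half-plane exactly
   when [sector_sign m k j]. *)
Definition sector_sign (m k j : nat) : bool := (k < j <= k + m)%N.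

(** Indices 0 and [m.*2] both stand for the sector outside all half-planes. *)
Lemma sector_sign_mod m k j : (k < m)%N -> (j < m.*2)%N ->
  sector_sign m k (j.+1 %% m.*2) = sector_sign m k j.+1.
Proof.
move=> km; rewrite leq_eqVlt => /orP[/eqP ->|jm]; last by rewrite modn_small.
by rewrite modnn /sector_sign; lia.
Qed.

Lemma sector_sign_inj m j j' : (j < m.*2)%N -> (j' < m.*2)%N ->
  (forall k, (k < m)%N -> sector_sign m k j = sector_sign m k j') -> j = j'.
Proof.
wlog lt_jj' : j j' / (j < j')%N.
  move=> H jm j'm E; have [jj'|jj'|//] := ltngtP j j'; first exact: H.
  by apply/esym/H => // k km; rewrite E.
move=> jm j'm E; rewrite /sector_sign in E.
have [jm'|mj] := ltnP j m; last by have := E (j - m)%N; lia.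
by have [?|?] := leqP j' (j + m); [have := E j|have := E (j' - m)%N]; lia.
Qed.

Lemma initial_segment m (P : pred 'I_m) :
    (forall i j : 'I_m, (i <= j)%N -> P j -> P i) ->
  exists2 n, (n <= m)%N & forall i, P i = (i < n)%N.
Proof.
elim: m P => [|m IH] P down; first by exists 0%N => // -[].
have [|n nm HP] := IH (fun i => P (widen_ord (leqnSn m) i)).
  by move=> i j ij; apply: down.
have [Pm|nPm] := boolP (P ord_max).
  by exists m.+1 => // i; rewrite ltn_ord (down i ord_max) // -ltnS.
exists n; first exact: leqW.
move=> i; have [im|mi] := ltnP i m.
  by rewrite -(HP (Ordinal im)); congr P; exact: val_inj.
have -> : i = ord_max by apply: val_inj; apply/eqP; rewrite eqn_leq mi -ltnS ltn_ord.
by rewrite (negbTE nPm) /=; apply/esym/negbTE; rewrite -leqNgt.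
Qed.

(** * Sectors of a pencil of hyperplanes and the values on them *)

Section Sectors.
Variables (K : realFieldType) (V : lmodType K) (m : nat).
Variables (g : 'I_m -> {scalar V}) (v p : V).
Hypotheses (gv : forall i, g i v = 1).
Hypothesis decr : forall i j : 'I_m, (i < j)%N -> g j p < g i p.

Lemma decr_ltE (i j : 'I_m) : (g j p < g i p) = (i < j)%N.
Proof.
apply/idP/idP => [|/decr//]; rewrite ltnNge; apply: contraTN.
by rewrite -leNgt leq_eqVlt => /orP[/eqP/val_inj->|/decr/ltW].
Qed.

(** In direction [v] the line through [p] meets the hyperplanes in the order of their indices,
    giving the walls after sectors 0 to [m - 1]; the opposite points lie on the other walls. *)
Lemma wall_point j : (j < m.*2)%N -> exists (i : 'I_m) w,
  [/\ g i w = 0,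
      sector_sign m i j.+1 = ~~ sector_sign m i j
    & forall k, k != i -> [/\ g k w != 0, (0 < g k w) = sector_sign m k j
        & sector_sign m k j.+1 = sector_sign m k j]].
Proof.
move=> jm; have gp (i k : 'I_m) : k != i -> g k p != g i p.
  by rewrite neq_ltn => /orP[]/decr lt; rewrite ?(gt_eqF lt) ?(lt_eqF lt).
have gw (i k : 'I_m) : g k (p - g i p *: v) = g k p - g i p.
  by rewrite linearB linearZ /= gv mulr1.
have [jm'|mj] := ltnP j m.
  exists (Ordinal jm'), (p - g (Ordinal jm') p *: v); split=> [||k kj].
  - by rewrite gw subrr.
  - by rewrite /sector_sign /=; lia.
  - split; first by rewrite gw subr_eq0 gp.
      rewrite gw subr_gt0 decr_ltE /sector_sign /=; lia.
    by move: kj; rewrite -val_eqE /sector_sign /=; lia.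
have jm' : (j - m < m)%N by lia.
exists (Ordinal jm'), (- (p - g (Ordinal jm') p *: v)); split=> [||k kj].
- by rewrite linearN /= gw subrr oppr0.
- by rewrite /sector_sign /=; lia.
- split; first by rewrite linearN /= gw oppr_eq0 subr_eq0 gp.
    rewrite linearN /= gw oppr_gt0 subr_lt0 decr_ltE.
    by move: kj (ltn_ord k); rewrite -val_eqE /sector_sign /=; lia.
  by move: kj (ltn_ord k); rewrite -val_eqE /sector_sign /=; lia.
Qed.

Hypothesis m_gt0 : (0 < m)%N.
Hypothesis plane : forall i j k : 'I_m, i != j ->
  exists l, forall x, g k x = l * g i x + (1 - l) * g j x.

(** The value at [p] is a coordinate on the affine line carrying the forms, and the value at [x] is
    an affine function of it. *)
Lemma pencil x : exists a e, forall k, g k x = e + a * g k p.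
Proof.
pose i := Ordinal m_gt0.
have [[j ij]|all_i] := pselect (exists j, i != j); last first.
  exists 0, (g i x) => k; rewrite mul0r addr0; congr (g _ x).
  by apply/eqP; rewrite eq_sym; apply/negPn/negP => ik; apply: all_i; exists k.
have d : g i p - g j p != 0.
  rewrite subr_eq0 gt_eqF //; apply: decr.
  by move: ij; rewrite -val_eqE /=; lia.
exists ((g i x - g j x) / (g i p - g j p)).
exists (g j x - (g i x - g j x) / (g i p - g j p) * g j p) => k.
by have [l lE] := plane k ij; rewrite !lE; field.
Qed.

(** By [pencil] the values [g k x] are monotone in [k], so the positive ones form an initial or a
    final segment. *)
Lemma sector_cover x : (forall k, g k x != 0) ->
  exists2 j, (j < m.*2)%N & forall k : 'I_m, (0 < g k x) = sector_sign m k j.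
Proof.
move=> gx; have [a [e xE]] := pencil x.
have le_p (i j : 'I_m) : (i <= j)%N -> g j p <= g i p.
  by rewrite leq_eqVlt => /orP[/eqP/val_inj->//|/decr/ltW].
have [a0|a0] := lerP 0 a.
  have [|n nm nE] := @initial_segment m (fun k => 0 < g k x).
    move=> i j /le_p ij; rewrite !xE => /lt_le_trans; apply.
    by rewrite lerD2l ler_wpM2l.
  by exists n => [|k]; rewrite ?nE /sector_sign; lia.
have [|n nm nE] := @initial_segment m (fun k => g k x < 0).
  move=> i j /le_p ij; rewrite !xE => /(le_lt_trans _); apply.
  by rewrite lerD2l ler_wnM2l // ltW.
have posE k : (0 < g k x) = (n <= k)%N.
  by rewrite leqNgt -nE -leNgt le_eqVlt eq_sym (negbTE (gx k)).
(* The first [n] forms are negative. If all are, the sector is 0, since [m + n] is out of range. *)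
have [nm'|mn] := ltnP n m.
  exists (m + n)%N => [|k]; first by lia.
  by rewrite posE /sector_sign; have := ltn_ord k; lia.
exists 0%N => [|k]; first by lia.
by rewrite posE /sector_sign; have := ltn_ord k; lia.
Qed.

Section SectorValues.
Variables (R : idomainType) (c : R) (b : 'I_m -> R).
Hypotheses (two_neq0 : (2 : R) != 0) (b_neq0 : forall i, b i != 0).
Hypothesis two_valued :
  forall x, (forall i, g i x != 0) -> step_sum g c b x = 0 \/ step_sum g c b x = 1.

Definition sector_value (j : nat) : R := c + \sum_(k < m | sector_sign m k j) b k.

Lemma step_sum_sector x j : (forall k : 'I_m, (0 < g k x) = sector_sign m k j) ->
  step_sum g c b x = sector_value j.
Proof. by move=> E; rewrite /step_sum /sector_value; congr (_ + _); apply: eq_bigl. Qed.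

Lemma sector_valueS j : (j < m.*2)%N ->
  sector_value j.+1 = 1 - sector_value j /\ (sector_value j = 0 \/ sector_value j = 1).
Proof.
move=> /wall_point[i [w [iw ij wP]]].
have [|x0 [x1 [nz0 nz1 same [lt0 gt1]]]] := cross_hyperplane gv iw.
  by move=> k /wP[].
have x01 : step_sum g c b x1 = step_sum g c b x0 + b i.
  apply: step_sum_add (ltW lt0) gt1 _ => k /same[<- <-] //.
have [bi F0 F1] : [/\ b i != 0, step_sum g c b x0 = 0 \/ step_sum g c b x0 = 1
    & step_sum g c b x1 = 0 \/ step_sum g c b x1 = 1].
  by split; [exact: b_neq0|exact: two_valued|exact: two_valued].
have x1E : step_sum g c b x1 = 1 - step_sum g c b x0.
  case: F0 F1 x01 => -> [] ->; rewrite ?subr0 ?subrr // ?add0r => /esym/eqP.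
    by rewrite (negbTE bi).
  by rewrite -subr_eq0 addrAC subrr add0r (negbTE bi).
(* [x0] is on the negative side of hyperplane [i]; it belongs to sector [j.+1] exactly when sector
   [j] is inside half-plane [i]. *)
have [ij0|ij0] := boolP (sector_sign m i j).
  have <- : step_sum g c b x1 = sector_value j.
    apply: step_sum_sector => k; have [->|ki] := eqVneq k i; first by rewrite ij0.
    by have [_ <- _] := wP k ki; have [_ <-] := same k ki.
  have <- : step_sum g c b x0 = sector_value j.+1.
    apply: step_sum_sector => k; have [->|ki] := eqVneq k i.
      by rewrite ij ij0 ltNge ltW.
    by have [_ <- ->] := wP k ki; have [<- _] := same k ki; have [_ -> _] := wP k ki.
  by rewrite x1E opprB addrC subrK -x1E; split.
have <- : step_sum g c b x0 = sector_value j.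
  apply: step_sum_sector => k; have [->|ki] := eqVneq k i.
    by rewrite (negbTE ij0) ltNge ltW.
  by have [_ <- _] := wP k ki; have [<- _] := same k ki.
have <- : step_sum g c b x1 = sector_value j.+1.
  apply: step_sum_sector => k; have [->|ki] := eqVneq k i; first by rewrite ij ij0.
  by have [_ E ->] := wP k ki; have [_ <-] := same k ki.
by rewrite x1E; split.
Qed.

Lemma sector_value_alternates j : (j < m.*2)%N ->
  sector_value j = if odd j then 1 - sector_value 0 else sector_value 0.
Proof.
elim: j => [//|j IH] jm; have jm' := ltnW jm.
have [-> _] := sector_valueS jm'; rewrite (IH jm') /=.
by case: (odd j); rewrite //= opprB addrC subrK.
Qed.

(* Opposite sectors carry values with a constant sum; for [m] even both would
   carry the same value, and this value would not depend on the sector. *)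
Lemma sector_count_odd : odd m.
Proof.
apply: contraT => even_m; have m2 : (1 < m)%N.
  by case: m m_gt0 even_m => [|[]].
pose i : 'I_m := Ordinal m_gt0.
have V0 : sector_value 0 = c.
  by rewrite /sector_value big_pred0 ?addr0 // => k; rewrite /sector_sign.
have V1 : sector_value 1 = c + b i.
  rewrite /sector_value (big_pred1 i) // => k.
  by rewrite /sector_sign /= -val_eqE /=; have := ltn_ord k; lia.
have Vm : sector_value m = c + \sum_(k < m) b k.
  congr (_ + _); apply: eq_bigl => k.
  by rewrite /sector_sign; have := ltn_ord k; lia.
have Vm1 : sector_value m.+1 = c + \sum_(k < m | k != i) b k.
  congr (_ + _); apply: eq_bigl => k.
  by rewrite /sector_sign /= -val_eqE /=; have := ltn_ord k; lia.
have e1 : sector_value m = sector_value 0.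
  by rewrite sector_value_alternates ?(negbTE even_m) //; lia.
have e2 : sector_value m.+1 = sector_value 1.
  rewrite (@sector_value_alternates m.+1) ?(@sector_value_alternates 1) /= ?even_m //; lia.
(* By [S0] all [b k] add up to 0; by [S1] those with [k != i] add up to [b i]. Hence
   [2 * b i = 0]. *)
move: e1 e2; rewrite V0 V1 Vm Vm1 (bigD1 i) //= -[RHS]addr0 => /addrI S0 /addrI S1.
have := b_neq0 i; have /eqP : 2 * b i = 0 by rewrite mulr_natl mulr2n -{2}S1.
by rewrite mulf_eq0 (negbTE two_neq0) /= => ->.
Qed.
End SectorValues.
End Sectors.

(** * Cells of constant sign: connectedness and closure *)

Section ScalarTopology.
Variables (K : realType) (l : nat).
Local Notation V := 'rV[K]_l.

Lemma scalar_continuous (f : {scalar V}) : continuous f.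
Proof.
have fE : (f : V -> K) = fun M => \sum_(j < l) M 0 j * f (delta_mx 0 j).
  apply/funext => M; rewrite [in LHS](row_sum_delta M) linear_sum /=.
  by apply: eq_bigr => j _; rewrite linearZ.
rewrite fE; apply: continuous_big => [|j _ M]; first exact: add_continuous.
exact: (cvgM (@coord_continuous K 1 l 0 j M) (cvg_cst _)).
Qed.

Lemma line_continuous (x y : V) : continuous (fun t : K => x + t *: (y - x)).
Proof.
move=> t; apply: (@cvgD K V); first exact: cvg_cst.
by apply: cvgZl; exact: cvg_id.
Qed.

Section SignCells.
Variables (I : finType) (B : {set I}) (f : I -> {scalar V}).

(** On a connected subset of the complement the values of [f i] form an interval avoiding 0;
    conversely, the segment between two points with equal signs stays in the complement. *)
Lemma component_same_sign x : (forall i, i \in B -> f i x != 0) ->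
  connected_component [set z | forall i, i \in B -> f i z != 0] x =
  [set z | forall i, i \in B -> 0 < f i x * f i z].
Proof.
move=> fx; apply/seteqP; split=> [z [C [Cx CD cC] Cz] i iB|z fz].
  have /connected_intervalP itv : connected (f i @` C).
    apply: connected_continuous_connected => //.
    exact/continuous_subspaceT/scalar_continuous.
  have n0 : ~ (f i @` C) 0.
    by move=> [w /CD /(_ _ iB)] /[swap] ->; rewrite eqxx.
  rewrite ltNge; apply/negP => xz; apply: n0.
  have fxC : (f i @` C) (f i x) by exists x.
  have fzC : (f i @` C) (f i z) by exists z.
  have [x0|x0] := lerP 0 (f i x).
    apply: (itv _ _ fzC fxC); rewrite x0 andbT.
    by move: xz; rewrite pmulr_rle0 // lt_neqAle eq_sym fx.
  apply: (itv _ _ fxC fzC); rewrite (ltW x0).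
  by move: xz; rewrite nmulr_rle0.
apply: (@connected_component_max _ _ ((fun t : K => x + t *: (z - x)) @` `[0, 1])).
- by exists 0; rewrite /= ?in_itv /= ?lexx ?ler01 // scale0r addr0.
- move=> _ [t] /= /[!in_itv] /= /andP[t0 t1] <- i iB.
  have := fz i iB; have := fx i iB; rewrite linearD linearZ linearB /=.
  set a := f i x; set d := f i z => a0 ad.
  suff : 0 < a * (a + t * (d - a)) by apply: contraTneq => ->; rewrite mulr0 ltxx.
  have -> : a * (a + t * (d - a)) = (1 - t) * a ^+ 2 + t * (a * d) by ring.
  have a2 : 0 < a ^+ 2 by rewrite exprn_even_gt0.
  have [->|tn1] := eqVneq t 1; first by rewrite subrr mul0r add0r mul1r.
  have p1 : 0 < (1 - t) * a ^+ 2 by rewrite mulr_gt0 // subr_gt0 lt_neqAle tn1.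
  have p2 : 0 <= t * (a * d) by rewrite mulr_ge0 // ltW.
  by rewrite ltr_pwDl.
- apply: connected_continuous_connected; first exact: segment_connected.
  exact/continuous_subspaceT/line_continuous.
- by exists 1; rewrite /= ?in_itv /= ?lexx ?ler01 // scale1r addrC subrK.
Qed.

(** For small [t > 0] the point [z + t *: (y - z)] lies in the cell. *)
Lemma closure_same_sign x y z :
    (forall i, i \in B -> 0 < f i x * f i y) ->
    (forall i, i \in B -> 0 <= f i x * f i z) ->
  closure [set w | forall i, i \in B -> 0 < f i x * f i w] z.
Proof.
move=> xy xz N Nz; have /= := @line_continuous z y 0 N.
rewrite scale0r addr0 => /(_ Nz) /nbhs_ballP[d /= d0 sub].
have [t [t0 t1 td]] : exists t : K, [/\ 0 < t, t <= 1 & t < d].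
  have [d1|d1] := lerP d 1; last by exists 1.
  by exists (d / 2); split; lra.
exists (z + t *: (y - z)); split; last first.
  by apply: (sub t); rewrite /ball /= sub0r normrN gtr0_norm.
move=> i iB /=; rewrite linearD linearZ linearB /=.
have := xy i iB; have := xz i iB; set a := f i x; set b := f i y; set c := f i z.
have -> : a * (c + t * (b - c)) = (1 - t) * (a * c) + t * (a * b) by ring.
move=> ac ab; have p1 : 0 < t * (a * b) by rewrite mulr_gt0.
have p2 : 0 <= (1 - t) * (a * c) by rewrite mulr_ge0 // subr_ge0.
by rewrite ltr_wpDl.
Qed.

Lemma near_same_sign x :
  \forall z \near x, forall i, f i x != 0 -> 0 < f i x * f i z.
Proof.
suff near_i i : \forall z \near x, f i x != 0 -> 0 < f i x * f i z.
  exact: (filter_forall (nbhs_filter x) near_i).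
have [fx|fx] := eqVneq (f i x) 0.
  by apply: (filterS _ (@filterT _ (nbhs x) _)) => z _; rewrite ?fx ?eqxx.
have : continuous_at x (fun z => f i x * f i z).
  exact: (cvgM (cvg_cst _) (@scalar_continuous (f i) x)).
move=> /(@cvgr_gt _ _ (nbhs x)) /(_ 0); rewrite -expr2 exprn_even_gt0 // => /(_ fx).
by apply: (@filterS _ (nbhs x)).
Qed.
End SignCells.
End ScalarTopology.

(** * Linear forms as scalar maps and the dimension of their kernels *)

Section HomScalar.
Variables (K : fieldType) (V : vectType K).

(* [K^o] and [K] have different canonical structures; as a function into [K], a
   linear form becomes a [{scalar V}]. *)
Definition form_val (f : 'Hom(V, K^o)) (x : V) : K := f x.

Fact form_val_is_scalar f : scalar (form_val f).
Proof. by move=> a x y; rewrite /form_val linearP. Qed.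

HB.instance Definition _ f :=
  GRing.isLinear.Build K V K *%R (form_val f) (form_val_is_scalar f).

Definition hom_scalar f : {scalar V} := form_val f.

Lemma dim_ker_form (f : 'Hom(V, K^o)) (U : {vspace V}) w :
  w \in U -> f w != 0 -> (\dim (U :&: lker f) + 1 = \dim U)%N.
Proof.
move=> wU fw; rewrite -(limg_ker_dim f U); congr (_ + _)%N.
apply/eqP; rewrite eq_sym eqn_leq; apply/andP; split.
  by rewrite (leq_trans (dimvS (subvf _))) // dimvf /dim /= /dim.
rewrite lt0n dimv_eq0; apply: contraNneq fw => im0.
by rewrite -memv0 -im0 memv_img.
Qed.

Lemma codim_ker2 (f g : 'Hom(V, K^o)) u w :
  f u != 0 -> g w != 0 -> f w = 0 ->
  (\dim {: V} - \dim (lker f :&: lker g) = 2)%N.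
Proof.
move=> fu gw fw.
have := dim_ker_form (memvf u) fu; rewrite capfv.
have : w \in lker f by rewrite memv_ker fw.
by move=> /dim_ker_form /(_ gw); lia.
Qed.
End HomScalar.

Lemma decreasing_enum (K : realFieldType) (I : finType) (B : {set I}) (f : I -> K) :
    injective f ->
  exists e : 'I_#|B| -> I, [/\ injective e, (e @: 'I_#|B|)%SET = B
    & forall k j : 'I_#|B|, (k < j)%N -> f (e j) < f (e k)].
Proof.
move=> f_inj; pose r i j := f j <= f i.
have r_total : total r by move=> i j; exact: le_total.
have r_trans : transitive r by move=> i j k /[swap]; exact: le_trans.
have r_refl : reflexive r by move=> i; exact: lexx.
pose s := sort r (enum B).
have sB : size s == #|B| by rewrite size_sort -cardE.
have s_uniq : uniq s by rewrite sort_uniq enum_uniq.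
pose e k := tnth (Tuple sB) k.
have e_inj : injective e by apply/tuple_uniqP.
exists e; split=> // [|k j kj].
  apply/setP => i; rewrite -[RHS]mem_enum -(mem_sort r (enum B)) -/s.
  apply/imsetP/idP => [[k _ ->]|/(tnthP (Tuple sB))[k ->]]; first exact: mem_tnth.
  by exists k.
rewrite lt_neqAle (inj_eq f_inj) (inj_eq e_inj) -val_eqE gtn_eqF //=.
rewrite /e !(tnth_nth (e k)) /=.
by apply: (sorted_leq_nth r_trans r_refl (e k) (sort_sorted r_total _));
  rewrite ?inE ?(eqP sB) // ltnW.
Qed.

(** * Chambers and sectors of an arrangement *)

Section Arrangement.
Variables (K : realType) (l : nat) (A : arrangement K l).
Local Notation V := 'rV[K]_l.
Local Notation n := (nbhyp A).

Definition form_scalar (i : 'I_n) : {scalar V} := hom_scalar (form i).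

Lemma notin_hyperplane i x : (x \notin hyperplane i) = (form_scalar i x != 0).
Proof. by rewrite memv_ker. Qed.

Lemma form_scalar_neq0 i : exists w, form_scalar i w != 0.
Proof.
apply: contrapT => no_w; have /negP := form_neq0 i; apply; apply/eqP/lfunP => w.
by rewrite zero_lfunE; apply/eqP/negPn/negP => fw; apply: no_w; exists w.
Qed.

Lemma generic_direction : exists v, forall i, form_scalar i v != 0.
Proof.
have [v _ Hv] := @generic_point _ _ _ form_scalar (fun _ => True) I
  (fun _ _ _ _ _ => I).
by exists v => i; have [w] := form_scalar_neq0 i; exact: Hv.
Qed.

Lemma chamber_of_vector x : (forall i, form_scalar i x != 0) ->
  exists C : ch A, set_val C x.
Proof.
move=> fx.
have Dx : complement [set: 'I_n]%SET x by move=> i _; rewrite notin_hyperplane.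
have Cx : ch A (connected_component (complement [set: 'I_n]%SET) x) by exists x.
by exists (SigSub (mem_set Cx)); exact: connected_component_refl.
Qed.

Lemma chamber_same_sign (C : ch A) x : set_val C x ->
  set_val C = [set z | forall i, 0 < form_scalar i x * form_scalar i z].
Proof.
have [x0 Dx0 CE] : ch A (set_val C) := set_valP C.
rewrite -CE => Cx.
have fx0 i : i \in [set: 'I_n]%SET -> form_scalar i x0 != 0.
  by move=> iT; rewrite -notin_hyperplane Dx0.
have DE : complement [set: 'I_n]%SET =
    [set z | forall i, i \in [set: 'I_n]%SET -> form_scalar i z != 0].
  by apply/seteqP; split=> z Dz i iT; have := Dz i iT; rewrite notin_hyperplane.
move: Cx; rewrite DE component_same_sign // => Cx.
have signE z i : (0 < form_scalar i x0 * form_scalar i z) =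
    (0 < form_scalar i x * form_scalar i z).
  have := Cx i (finset.in_setT i); set a := form_scalar i x0; set b := form_scalar i x.
  by case: (ltgtP a 0) => [a0|a0|->]; rewrite ?mul0r ?ltxx //;
    rewrite ?(nmulr_rgt0 _ a0) ?(pmulr_rgt0 _ a0) => b0;
    rewrite ?(nmulr_rgt0 _ b0) ?(pmulr_rgt0 _ b0).
by apply/seteqP; split=> z Cz i; have := Cz i; rewrite signE // => /(_ (finset.in_setT i)).
Qed.

Lemma chamber_vector (C : ch A) :
  exists2 x, set_val C x & forall i, form_scalar i x != 0.
Proof.
have [x Dx CE] : ch A (set_val C) := set_valP C.
exists x; first by rewrite -CE; exact: connected_component_refl.
by move=> i; rewrite -notin_hyperplane Dx.
Qed.

Section Normalized.
Variables (v p : V) (m : nat) (e : 'I_m -> 'I_n) (B : {set 'I_n}).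
Hypotheses (fv : forall i, form_scalar i v != 0) (eB : (e @: 'I_m)%SET = B).

Definition normalized_form i : {scalar V} := hom_scalar ((form_scalar i v)^-1 *: form i).

Lemma normalized_formE i x : normalized_form i x = (form_scalar i v)^-1 * form_scalar i x.
Proof. by rewrite /= /form_val scale_lfunE. Qed.

Lemma normalized_form1 i : normalized_form i v = 1.
Proof. by rewrite normalized_formE mulVf. Qed.

Lemma normalized_form_eq0 i x : (normalized_form i x == 0) = (form_scalar i x == 0).
Proof. by rewrite normalized_formE mulf_eq0 invr_eq0 (negbTE (fv i)). Qed.

(** The normalizing factor, possibly negative, enters the product squared. *)
Lemma normalized_form_same_sign i x z : 0 < form_scalar i x * form_scalar i z ->
  0 < normalized_form i x * normalized_form i z.
Proof.
move=> xz; have vv : 0 < (form_scalar i v)^-1 * (form_scalar i v)^-1.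
  by rewrite -expr2 exprn_even_gt0 //= invr_eq0; exact: fv.
by rewrite !normalized_formE mulrACA; exact: mulr_gt0 vv xz.
Qed.

Lemma normalized_form_inj i j : i != j ->
  exists x, normalized_form i x != normalized_form j x.
Proof.
move=> ij; apply: contrapT => E; have /negP := ij; apply; apply/eqP.
apply: (@form_ker_inj _ _ A); apply/vspaceP => x.
have eqx : normalized_form i x = normalized_form j x.
  by apply/eqP/negPn/negP => ne; apply: E; exists x.
by rewrite !memv_ker -![form _ x == 0]/(form_scalar _ x == 0) -!normalized_form_eq0 eqx.
Qed.

Local Notation g := (fun k => normalized_form (e k)).

(** The condition [g k x != 0] removes the walls, where [0 < g k x] is false as on the negative
    side. *)
Definition sector (j : nat) : set V :=
  [set x | forall k, g k x != 0 /\ (0 < g k x) = sector_sign m k j].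

Lemma complement_normalized :
  complement B = [set z | forall k, k \in [set: 'I_m]%SET -> g k z != 0].
Proof.
apply/seteqP; split=> z Dz => [k _|i].
  rewrite normalized_form_eq0 -notin_hyperplane; apply: Dz.
  by rewrite -eB imset_f.
rewrite -eB => /imsetP[k _ ->]; rewrite notin_hyperplane -normalized_form_eq0.
exact/Dz/finset.in_setT.
Qed.

Lemma sector_same_sign j x : sector j x ->
  sector j = [set z | forall k, k \in [set: 'I_m]%SET -> 0 < g k x * g k z].
Proof.
move=> Sx; apply/seteqP; split=> z Sz k => [_|].
  have [x0 xs] := Sx k; have [z0 zs] := Sz k.
  move: zs; rewrite -xs; case: (ltgtP (g k x) 0) x0 => // x0 _ zs.
    by rewrite (nmulr_rgt0 _ x0) lt_neqAle z0 leNgt zs.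
  by rewrite (pmulr_rgt0 _ x0) zs.
have [_ <-] := Sx k; have xz := Sz k (finset.in_setT k).
split; last by rewrite (same_sign xz).
exact: same_sign_neq0 xz.
Qed.

Lemma sector_component j x : sector j x ->
  complement B x /\ connected_component (complement B) x = sector j.
Proof.
move=> Sx; have gx k : k \in [set: 'I_m]%SET -> g k x != 0.
  by have [] := Sx k.
by rewrite complement_normalized (sector_same_sign Sx) component_same_sign.
Qed.

Hypothesis decr : forall i j : 'I_m, (i < j)%N -> g j p < g i p.
Hypothesis m_gt0 : (0 < m)%N.
Hypothesis plane : forall i j k : 'I_m, i != j ->
  exists a, forall x, g k x = a * g i x + (1 - a) * g j x.

(** Leaving the point of [wall_point] on both sides reaches the two neighbouring sectors. This
    serves for the shared walls and for nonemptiness. *)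
Lemma sector_crossing j : (j < m.*2)%N -> exists (i : 'I_m) w x0 x1,
  [/\ g i w = 0, forall k, k != i -> 0 < g k w * g k x0 /\ 0 < g k w * g k x1,
    sector j x0 & sector (j.+1 %% m.*2)%N x1].
Proof.
move=> jm; have [i [w [iw ij wP]]] := wall_point (fun k => normalized_form1 (e k)) decr jm.
have [|x0 [x1 [nz0 nz1 same [lt0 gt1]]]] :=
  @cross_hyperplane _ _ _ g v (fun k => normalized_form1 (e k)) w i iw.
  by move=> k /wP[].
have wx x : (forall k, g k x != 0) ->
    (forall k, k != i -> (0 < g k w) = (0 < g k x)) ->
    forall k, k != i -> 0 < g k w * g k x.
  move=> nz E k ki; have [w0 _ _] := wP k ki; move: (E k ki).
  case: (ltgtP (g k w) 0) w0 => // w0 _ xs.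
    by rewrite (nmulr_rgt0 _ w0) lt_neqAle nz leNgt -xs.
  by rewrite (pmulr_rgt0 _ w0) -xs.
have W0 := wx _ nz0 (fun k ki => (same k ki).1).
have W1 := wx _ nz1 (fun k ki => (same k ki).2).
have Sx x j' : (forall k, g k x != 0) -> (0 < g i x) = sector_sign m i j' ->
    (forall k, k != i -> (0 < g k w) = (0 < g k x)) ->
    (forall k, k != i -> (0 < g k w) = sector_sign m k j') -> sector j' x.
  move=> nz xi xw wj k; split=> //.
  by have [->//|ki] := eqVneq k i; rewrite -xw // wj.
have S1 (k : 'I_m) : sector_sign m k (j.+1 %% m.*2)%N = sector_sign m k j.+1.
  exact: (sector_sign_mod (ltn_ord k) jm).
have wj k : k != i -> (0 < g k w) = sector_sign m k j by move=> /wP[].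
have wj1 k : k != i -> (0 < g k w) = sector_sign m k (j.+1 %% m.*2)%N.
  by move=> ki; have [_ -> E] := wP k ki; rewrite S1 E.
have x0w k (ki : k != i) := (same k ki).1.
have x1w k (ki : k != i) := (same k ki).2.
exists i, w; have [ij0|ij0] := boolP (sector_sign m i j).
  exists x1, x0; split=> // [k ki||]; first by split; [exact: W1|exact: W0].
    by apply: Sx; rewrite // gt1 ij0.
  by apply: Sx; rewrite // S1 ij ij0 ltNge ltW.
exists x0, x1; split=> // [k ki||]; first by split; [exact: W0|exact: W1].
  by apply: Sx; rewrite // (negbTE ij0) ltNge ltW.
by apply: Sx; rewrite // S1 ij ij0 gt1.
Qed.

(** Near [w] only [g i] can change sign, so the nearby points of its hyperplane are limits of both
    sectors. *)
Lemma sector_share_wall j : (j < m.*2)%N ->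
  share_wall B (sector j) (sector (j.+1 %% m.*2)%N).
Proof.
move=> /sector_crossing[i [w [x0 [x1 [iw wx S0 S1]]]]].
have hypE z : (z \in hyperplane (e i)) = (g i z == 0).
  by rewrite normalized_form_eq0 -[LHS]negbK notin_hyperplane negbK.
exists (e i), w; split; first by rewrite -eB imset_f.
  by rewrite hypE iw.
have := @near_same_sign _ _ _ g w; apply: (@filterS _ (nbhs w)) => z wz.
rewrite hypE => /eqP iz.
have clo x j' : sector j' x -> (forall k, k != i -> 0 < g k w * g k x) ->
    closure (sector j') z.
  move=> Sx wx'; rewrite (sector_same_sign Sx).
  apply: (@closure_same_sign _ _ _ _ g x x z) => k _.
    by have [x0' _] := Sx k; rewrite -expr2 exprn_even_gt0.
  have [->|ki] := eqVneq k i; first by rewrite iz mulr0.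
  have kwx := wx' k ki.
  have w0 : g k w != 0 by apply: contraTneq kwx => ->; rewrite mul0r ltxx.
  have := wz k w0; move: kwx; case: (ltgtP (g k w) 0) w0 => // w0 _.
    by rewrite !(nmulr_rgt0 _ w0) => x0' z0; rewrite (nmulr_rge0 _ x0') ltW.
  by rewrite !(pmulr_rgt0 _ w0) => x0' z0; rewrite (pmulr_rge0 _ x0') ltW.
by split; [apply: clo S0 _|apply: clo S1 _] => k /wx[].
Qed.

(** Signs are constant on a chamber, and a chamber is nonempty. *)
Lemma chamber_sector (C : ch A) : exists2 j, (j < m.*2)%N &
  forall j', (j' < m.*2)%N -> set_val C `<=` sector j' <-> j' = j.
Proof.
have [x Cx fx] := chamber_vector C.
have gx k : g k x != 0 by rewrite normalized_form_eq0.
have [j jm Sx] := sector_cover decr m_gt0 plane gx.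
exists j => // j' j'm; split=> [/(_ x Cx) Sx'|-> z].
  apply: (sector_sign_inj j'm jm) => k km.
  by have [_ <-] := Sx' (Ordinal km); rewrite -(Sx (Ordinal km)).
rewrite (chamber_same_sign Cx) => Cz k.
have xz : 0 < g k x * g k z by exact/normalized_form_same_sign/Cz.
split; first exact: same_sign_neq0 xz.
by rewrite -(same_sign xz) -Sx.
Qed.

(** [M] stands for the [4 * s + 2] of the theorem, equal to [m.*2] but not convertible with it. *)
Lemma sectors_cyclic_numbering M : M = m.*2 ->
  cyclic_numbering B (fun j : 'I_M => sector j).
Proof.
move=> ME; have jM (j : 'I_M) : (j < m.*2)%N by rewrite -ME.
split; last by move=> j; have := sector_share_wall (jM j); rewrite -ME.
have ex j : (j < m.*2)%N -> exists x, sector j x.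
  by move=> /sector_crossing[_ [_ [x [_ [_ _ ? _]]]]]; exists x.
split=> [j _|j j' _ _ jj'|_ [x Dx <-]].
- by have [x Sx] := ex j (jM j); have [Dx <-] := sector_component Sx; exists x.
- have [x Sx] := ex j (jM j); have Sx' : sector j' x by rewrite -jj'.
  apply: val_inj; apply: (sector_sign_inj (jM j) (jM j')) => k km.
  by have [_ <-] := Sx (Ordinal km); have [_ <-] := Sx' (Ordinal km).
- have gx k : g k x != 0.
    by move: Dx; rewrite complement_normalized => /(_ k (finset.in_setT k)).
  have [j jm Sx] := sector_cover decr m_gt0 plane gx.
  rewrite -ME in jm; exists (Ordinal jm) => //=.
  by have [_ ->] := @sector_component j x (fun k => conj (gx k) (Sx k)).
Qed.
End Normalized.
End Arrangement.

(** * Elements of [Fil1] and [gHeav] evaluated at vectors *)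

Section GeneralizedHeaviside.
Variables (K : realType) (l : nat) (A : arrangement K l) (R : idomainType).
Local Notation V := 'rV[K]_l.
Local Notation n := (nbhyp A).

Lemma heaviside_value (i : 'I_n) (C : ch A) x : set_val C x ->
  heaviside R i C = (0 < form_scalar i x)%R%:R.
Proof.
move=> Cx; rewrite /heaviside indicE; congr (nat_of_bool _)%:R.
apply/idP/idP => [/set_mem /(_ x Cx) //|x0]; apply/mem_set => z.
by rewrite (chamber_same_sign Cx) => /(_ i); rewrite (pmulr_rgt0 _ x0).
Qed.

Lemma Fil1_value (y : VG A R) c a (C : ch A) x :
    y = c *: (1 : VG A R) + \sum_i a i *: heaviside R i -> set_val C x ->
  y C = step_sum (@form_scalar K l A) c a x.
Proof.
move=> -> Cx; rewrite /step_sum [in RHS]big_mkcond.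
rewrite [LHS]/(c * 1 + (\sum_i a i *: heaviside R i : ch A -> R^o) C) mulr1.
congr (_ + _); rewrite fct_sumE /=; apply: eq_bigr => i _.
transitivity (a i * (0 < form_scalar i x)%R%:R : R).
  by rewrite -(heaviside_value i Cx).
by rewrite -[form_val _ x]/(form_scalar i x); case: ifP; rewrite ?mulr1 ?mulr0.
Qed.

Lemma idempotent_value (y : VG A R) : y ^+ 2 = y ->
  forall C, y C = 0 \/ y C = 1.
Proof.
move=> y2 C; have /eqP : y C * y C = y C by rewrite -[in RHS]y2 expr2.
rewrite -subr_eq0 -{3}[y C]mulr1 -mulrBr mulf_eq0 subr_eq0.
by move=> /orP[]/eqP; auto.
Qed.

(** For a form negative at [v], off its hyperplane, the Heaviside function is 1 minus the normalized
    one: [a i] is added to the constant and the coefficient changes sign. *)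
Lemma step_sum_normalized (v : V) m (e : 'I_m -> 'I_n) (c : R) (a : 'I_n -> R) :
    (forall i : 'I_n, form_scalar i v != 0) -> injective e ->
    (e @: 'I_m)%SET = [set i | a i != 0]%SET ->
  exists c' b, [/\ forall k, b k != 0
    & forall x, (forall k, form_scalar (e k) x != 0) ->
      step_sum (@form_scalar K l A) c a x =
      step_sum (fun k => normalized_form v (e k)) c' b x].
Proof.
move=> fv e_inj eB.
pose neg k := form_scalar (e k) v < 0.
exists (c + \sum_k if neg k then a (e k) else 0).
exists (fun k => if neg k then - a (e k) else a (e k)); split=> [k|x fx].
  have : e k \in [set i | a i != 0]%SET by rewrite -eB imset_f.
  by rewrite inE; case: ifP; rewrite ?oppr_eq0.
rewrite /step_sum -addrA; congr (_ + _).
rewrite big_mkcond /= (bigID (fun i => i \in [set i | a i != 0]%SET)) /=.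
rewrite [X in _ + X]big1 ?addr0; last first.
  by move=> i; rewrite inE negbK => /eqP ->; case: ifP.
rewrite -eB big_imset /=; last by move=> k j _ _; exact: e_inj.
rewrite [X in _ = _ + X]big_mkcond -big_split /=; apply: eq_big => // k _.
rewrite normalized_formE /neg; have := fx k; have := fv (e k).
case: (ltgtP (form_scalar (e k) v) 0) => // v0 _ fxk.
  rewrite nmulr_rgt0 ?invr_lt0 //; case: (ltgtP (form_scalar (e k) x) 0) fxk => // _ _.
    by rewrite subrr.
  by rewrite addr0.
by rewrite pmulr_rgt0 ?invr_gt0 // add0r.
Qed.

End GeneralizedHeaviside.

Theorem theorem4p2 (K : realType) (l : nat) (A : arrangement K l)
    (R : idomainType) (charR : 2%N \notin [pchar R]%R)
    (y : VG A R) (gHeav_y : gHeav y) :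
  exists (s : nat) (B : {set 'I_(nbhyp A)})
    (cone : 'I_(4 * s + 2)%N -> set 'rV[K]_l),
    [/\ #|B| = (2 * s + 1)%N,
        (0 < s)%N -> codim (\bigcap_(i in B) hyperplane i)%VS = 2%N,
        cyclic_numbering B cone &
        y = Alt_plus A R cone \/ y = Alt_minus A R cone].
Proof.
have [[c [a yE]] y2 y0 y1] := gHeav_y.
have two_neq0 : (2 : R) != 0 by move: charR; rewrite inE.
have [v fv] := generic_direction A.
pose B : {set 'I_(nbhyp A)} := [set i | a i != 0]%SET.
have [p _ Hp] := @generic_point _ _ _
  (fun ij : 'I_(nbhyp A) * 'I_(nbhyp A) => normalized_form v ij.1 \- normalized_form v ij.2)
  (fun _ => True) Logic.I (fun _ _ _ _ _ => Logic.I).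
have p_inj : injective (fun i : 'I_(nbhyp A) => normalized_form v i p).
  move=> i j ijp; apply/eqP/negPn/negP => ij.
  have [w gw] := normalized_form_inj fv ij.
  by have := Hp (i, j) w Logic.I; rewrite /= ijp subrr eqxx subr_eq0 => /(_ gw).
have [e [e_inj eB decr]] := decreasing_enum B p_inj.
set m := #|B| in e e_inj eB decr.
have [c' [b [b0 sumE]]] := step_sum_normalized c fv e_inj eB.
pose g k := normalized_form v (e k).
have g1 k : g k v = 1 by exact: normalized_form1.
have yv (C : ch A) x : set_val C x -> y C = step_sum g c' b x.
  move=> Cx; rewrite (Fil1_value yE Cx) sumE // => k.
  have := Cx; rewrite (chamber_same_sign Cx) => /(_ (e k)).
  exact: same_sign_neq0.
have two_valued x : (forall k, g k x != 0) ->
    step_sum g c' b x = 0 \/ step_sum g c' b x = 1.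
  (* [x] may lie on hyperplanes outside [B]; a short move along [v] leaves them and keeps all
     nonzero signs. *)
  move=> gx; have [d d0 D] := perturb_same_sign (@form_scalar K l A) x v.
  have [|C Cx] := @chamber_of_vector _ _ A (x + d *: v).
    move=> i; have [xi|/D] := eqVneq (form_scalar i x) 0.
      rewrite linearD linearZ xi add0r; apply: mulf_neq0; last exact: fv.
      by rewrite gt_eqF.
    exact: same_sign_neq0.
  rewrite (_ : step_sum g c' b x = y C); first exact: idempotent_value.
  rewrite (yv C _ Cx); apply: eq_step_sum => k.
  have fx : form_scalar (e k) x != 0 by rewrite -(normalized_form_eq0 fv); exact: gx.
  exact/same_sign/normalized_form_same_sign/D.
(* With [B] empty, [y] would be constant, hence 0 or 1. *)
have m_gt0 : (0 < m)%N.
  rewrite lt0n; apply/eqP => m0.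
  have [C0 _] := chamber_of_vector fv.
  have yc C : y C = c'.
    have [x /yv -> _] := chamber_vector C; rewrite /step_sum big1 ?addr0 // => k.
    by have := ltn_ord k; rewrite [X in (_ < X)%N]m0.
  case: (idempotent_value y2 C0); rewrite yc => c'E.
    by apply: y0; apply/funext => C; rewrite yc.
  by apply: y1; apply/funext => C; rewrite yc.
have g_inj i j : i != j -> exists x, g i x != g j x.
  by move=> ij; apply: normalized_form_inj; rewrite ?(inj_eq e_inj).
have plane i j k : i != j -> exists t, forall x, g k x = t * g i x + (1 - t) * g j x.
  exact: (coplanar two_neq0 g1 g_inj b0 two_valued).
have m_odd : odd m := sector_count_odd g1 decr m_gt0 two_neq0 b0 two_valued.
have mE : m = (2 * m./2 + 1)%N by rewrite -[LHS]odd_double_half m_odd; lia.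
have ME : (4 * m./2 + 2 = m.*2)%N by lia.
exists m./2, B, (fun j => sector v e j); split.
- by rewrite -mE.
- move=> s0.
  (* Two forms cut out the whole intersection, the others being combinations of them by [plane]. *)
  have m1 : (1 < m)%N by lia.
  pose i := Ordinal m_gt0; pose j := Ordinal m1.
  have ij : i != j by [].
  have [u [w [iu ju iw jw _]]] := dual_pair (g1 i) (g1 j) (g_inj i j ij).
  have fE k x : g k x != 0 -> form (e k) x != 0.
    by rewrite normalized_form_eq0.
  have fE0 k x : g k x = 0 -> form (e k) x = 0.
    by move/eqP; rewrite normalized_form_eq0 // => /eqP.
  rewrite (_ : (\bigcap_(i in B) hyperplane i)%VS =
      (lker (form (e i)) :&: lker (form (e j)))%VS); last first.
    apply/eqP; rewrite eqEsubv; apply/andP; split.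
      rewrite subv_cap (bigcapv_inf (e i)) ?(bigcapv_inf (e j)) //;
        by rewrite -eB imset_f.
    apply/subv_bigcapP => _ /[!(esym eB)] /imsetP[k _ ->].
    apply/subvP => x; rewrite memv_cap !memv_ker => /andP[ix jx].
    have [t tE] := plane i j k ij.
    rewrite -[_ == 0]/(form_scalar _ x == 0) -(normalized_form_eq0 fv).
    rewrite [X in X == 0]tE.
    have -> : g i x = 0 by apply/eqP; rewrite normalized_form_eq0.
    have -> : g j x = 0 by apply/eqP; rewrite normalized_form_eq0.
    by rewrite !mulr0 addr0.
  apply: (@codim_ker2 _ _ _ _ u w).
  + by rewrite fE // iu oner_neq0.
  + by rewrite fE // jw oner_neq0.
  + exact: fE0.
- exact: (sectors_cyclic_numbering fv eB decr m_gt0 plane ME).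
set G := sector_value c' b.
have G0 : G 0%N = 0 \/ G 0%N = 1.
  by have [|_] := @sector_valueS _ _ _ g v p g1 decr _ c' b b0 two_valued 0; first by lia.
have GE j : (j < m.*2)%N -> G j = if odd j then 1 - G 0%N else G 0%N.
  exact: (sector_value_alternates g1 decr b0 two_valued).
set cone := fun j : 'I_(4 * m./2 + 2) => sector v e j.
have yC (C : ch A) : exists2 even_j : bool, y C = (if even_j then G 0%N else 1 - G 0%N)
    & Alt_plus A R cone C = even_j%:R.
  have [j jm CE] := chamber_sector fv decr m_gt0 plane C.
  exists (~~ odd j).
    have [x Cx _] := chamber_vector C.
    rewrite (yv C x Cx) (@step_sum_sector _ _ _ g _ c' b x j) => [|k].
      by rewrite -/G (GE j jm); case: (odd j).
    by have [] := (CE j jm).2 erefl x Cx k.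
  rewrite /Alt_plus indicE; congr (nat_of_bool _)%:R.
  apply/idP/idP => [/set_mem[j' ev /CE <-//]|ev]; first by rewrite -ME.
  apply/mem_set; have jM : (j < 4 * m./2 + 2)%N by rewrite ME.
  by exists (Ordinal jM) => //; apply/CE.
(* The value on sector 0, the cone numbered 1, decides between the two functions. *)
case: G0 => G0; [right|left]; apply/funext => C.
  rewrite /Alt_minus -[RHS]/(1 - Alt_plus A R cone C).
  by have [ev -> ->] := yC C; rewrite G0; case: ev; rewrite ?subrr ?subr0.
by have [ev -> ->] := yC C; rewrite G0; case: ev; rewrite ?subrr.
Qed.
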